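(* Let $f \colon \mathbb{R}^n \to \mathbb{R} \cup \{+\infty\}$ be a lower semi-continuous function and let $\Omega \subset \mathbb{R}^n$ be a closed set such that: (A1) $\mathrm{dom} f \cap \Omega$ is unbounded; (A2) $\partial^\infty f(\infty) \cap (-N_\Omega(\infty)) = \{0\}$; (A3) $f$ is bounded from below on $\Omega$, i.e., $f_* := \inf_{x \in \Omega} f(x)$ is finite. Let $\mathrm{Sol} := \{x \in \Omega \mid f(x) = f_*\}$ be the set of optimal solutions of the problem of minimizing $f$ over $\Omega$. Assume that $0 \notin \partial f(\infty) + N_\Omega(\infty)$. Then: (i) $\mathrm{Sol}$ is nonempty and compact. (ii) There exist constants $c > 0$ and $R > 0$ such that $$f(x) - f_* \ge c\, \mathrm{dist}(x, \mathrm{Sol}) \quad \text{for all } x \in \Omega \text{ with } \|x\| > R.$$ (iii) $f$ is coercive on $\Omega$, i.e., if $\|x\| \to \infty$ with $x \in \Omega$, then $f(x) \to \infty$.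
   Context: $\mathbb{R}^n$ carries the Euclidean norm and scalar product. $\mathrm{dom} f := \{x \mid f(x) < \infty\}$ and $\mathrm{epi} f := \{(x,r) \in \mathbb{R}^n \times \mathbb{R} \mid f(x) \le r\}$. $\mathrm{dist}(x, S) := \inf_{y \in S}\|x - y\|$. Regular normal cone: for a set $C \subset \mathbb{R}^N$ and $z \in C$, $\widehat{N}_C(z)$ is the set of $\xi \in \mathbb{R}^N$ with $\langle \xi, z' - z\rangle \le o(\|z' - z\|)$ as $z' \to z$, $z' \in C$. Normal cone at infinity: for an unbounded closed set $\Omega \subset \mathbb{R}^n$, $N_\Omega(\infty)$ is the set of all $\xi \in \mathbb{R}^n$ for which there exist $x_k \in \Omega$ with $\|x_k\| \to \infty$ and $\xi_k \in \widehat{N}_\Omega(x_k)$ with $\xi_k \to \xi$. Subdifferentials at infinity: for $f \colon \mathbb{R}^n \to \mathbb{R} \cup \{+\infty\}$ with $\mathrm{dom} f$ unbounded, let $N_{\mathrm{epi} f}(\infty_I)$ (with $I = \{1,\dots,n\} \subset \{1,\dots,n+1\}$) be the set of all $\zeta \in \mathbb{R}^{n+1}$ for which there exist $(x_k, r_k) \in \mathrm{epi} f$ with $\|x_k\| \to \infty$ and $\zeta_k \in \widehat{N}_{\mathrm{epi} f}(x_k, r_k)$ with $\zeta_k \to \zeta$. Then $\partial f(\infty) := \{u \in \mathbb{R}^n \mid (u,-1) \in N_{\mathrm{epi} f}(\infty_I)\}$ and $\partial^\infty f(\infty) := \{u \in \mathbb{R}^n \mid (u,0) \in N_{\mathrm{epi}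 f}(\infty_I)\}$. *)

(* Defs.v *)
From HB Require Import structures.
From mathcomp Require Import all_boot all_order all_algebra.
From mathcomp Require Import all_classical all_reals all_analysis.
Set Implicit Arguments.
Unset Strict Implicit.
Unset Printing Implicit Defensive.
Import Order.TTheory GRing.Theory Num.Theory.
Import numFieldNormedType.Exports.
Local Open Scope classical_set_scope.
Local Open Scope ring_scope.

(* The library norm on 'rV[R]_n is the max norm, so the Euclidean structure is
   introduced here. The library topology on 'rV[R]_n (used for closed, compact,
   convergence and lower_semicontinuous) is the Euclidean one. *)
Definition dotp (R : realType) (n : nat) (u v : 'rV[R]_n) : R :=
  \sum_(i < n) u ord0 i * v ord0 i.

Definition enorm (R : realType) (n : nat) (u : 'rV[R]_n) : R :=
  Num.sqrt (dotp u u).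

Definition unbounded (R : realType) (n : nat) (A : set 'rV[R]_n) : Prop :=
  ~ exists M : R, forall x, A x -> enorm x <= M.

(* Extended-real valued: the distance to the empty set is +oo. *)
Definition edistance (R : realType) (n : nat) (x : 'rV[R]_n)
    (S : set 'rV[R]_n) : \bar R :=
  ereal_inf [set (enorm (x - y))%:E | y in S].

Definition regular_normal_cone (R : realType) (N : nat) (C : set 'rV[R]_N)
    (z : 'rV[R]_N) : set 'rV[R]_N :=
  [set xi | C z /\ forall e : R, 0 < e ->
    \forall z' \near z, C z' -> dotp xi (z' - z) <= e * enorm (z' - z)].

Definition normal_cone_infty (R : realType) (n : nat) (Omega : set 'rV[R]_n) :
    set 'rV[R]_n :=
  [set xi | exists (x_ : nat -> 'rV[R]_n) (xi_ : nat -> 'rV[R]_n),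
    [/\ forall k, Omega (x_ k),
        enorm (x_ k) @[k --> \oo] --> +oo,
        forall k, regular_normal_cone Omega (x_ k) (xi_ k)
      & xi_ k @[k --> \oo] --> xi]].

Definition edom (R : realType) (n : nat) (f : 'rV[R]_n -> \bar R) :
    set 'rV[R]_n :=
  [set x | (f x < +oo)%E].

(* R^n x R is represented as R^(n+1), with (x, r) encoded by row_mx. *)
Definition pt (R : realType) (n : nat) (x : 'rV[R]_n) (r : R) : 'rV[R]_(n + 1) :=
  row_mx x (const_mx r).

Definition epi (R : realType) (n : nat) (f : 'rV[R]_n -> \bar R) :
    set 'rV[R]_(n + 1) :=
  [set z | exists (x : 'rV[R]_n) (r : R), z = pt x r /\ (f x <= r%:E)%E].

Definition epi_normal_cone_infty (R : realType) (n : nat)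
    (f : 'rV[R]_n -> \bar R) : set 'rV[R]_(n + 1) :=
  [set zeta | exists (x_ : nat -> 'rV[R]_n) (r_ : nat -> R)
      (zeta_ : nat -> 'rV[R]_(n + 1)),
    [/\ forall k, epi f (pt (x_ k) (r_ k)),
        enorm (x_ k) @[k --> \oo] --> +oo,
        forall k, regular_normal_cone (epi f) (pt (x_ k) (r_ k)) (zeta_ k)
      & zeta_ k @[k --> \oo] --> zeta]].

Definition subdiff_infty (R : realType) (n : nat) (f : 'rV[R]_n -> \bar R) :
    set 'rV[R]_n :=
  [set u | epi_normal_cone_infty f (pt u (-1))].

Definition singular_subdiff_infty (R : realType) (n : nat)
    (f : 'rV[R]_n -> \bar R) : set 'rV[R]_n :=
  [set u | epi_normal_cone_infty f (pt u 0)].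

Definition fstar (R : realType) (n : nat) (f : 'rV[R]_n -> \bar R)
    (Omega : set 'rV[R]_n) : \bar R :=
  ereal_inf [set f x | x in Omega].

Definition Sol (R : realType) (n : nat) (f : 'rV[R]_n -> \bar R)
    (Omega : set 'rV[R]_n) : set 'rV[R]_n :=
  [set x | Omega x /\ f x = fstar f Omega].

Definition coercive_on (R : realType) (n : nat) (f : 'rV[R]_n -> \bar R)
    (Omega : set 'rV[R]_n) : Prop :=
  forall M : R, exists r : R, forall x, Omega x -> r < enorm x -> (M%:E < f x)%E.

(* Main.v *)
Require Import Defs.
From mathcomp Require Import all_boot all_order all_algebra.
From mathcomp Require Import all_classical all_reals all_analysis.
From mathcomp Require Import ring lra.
Import Order.TTheory GRing.Theory Num.Theory.
Import numFieldNormedType.Exports.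
Local Open Scope classical_set_scope.
Local Open Scope ring_scope.

(* Suppose [f - f_*] does not grow linearly on [Omega]: there are far points
   [x0] in [Omega] with [f x0 - f_* < |x0| / k]. Minimize
   [f x + a |y - x0|^2 + kappa |x - y|^2] over [y] in [Omega] and [x], [y] in
   balls around [x0] of radius about [|x0| / 2], with [a = 4 / (k |x0|)]. For
   [kappa] large the constraints given by the balls are inactive, so the
   minimizers carry regular normals [(u, -1)] of [epi f] and
   [- u - 2 a (y - x0)] of [Omega], the residual [2 a (y - x0)] being at most
   [4 / k]. Letting [k] tend to infinity after scaling [u] to norm at most [1]
   contradicts the qualification condition or
   [0 \notin subdiff_infty f + N_Omega(infty)]. This quadratic penalization
   replaces both Ekeland's variational principle and the fuzzy sum rule. *)

(** * Euclidean norm and its comparison with the library topology *)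

Section Euclidean.
Context {R : realType} {n : nat}.
Implicit Types (u v w : 'rV[R]_n) (a : R).

Lemma dotpC u v : dotp u v = dotp v u.
Proof. by apply: eq_bigr => i _; rewrite mulrC. Qed.

Lemma dotpDl u v w : dotp (u + v) w = dotp u w + dotp v w.
Proof. by rewrite -big_split; apply: eq_bigr => i _; rewrite mxE mulrDl. Qed.

Lemma dotpZl a u v : dotp (a *: u) v = a * dotp u v.
Proof. by rewrite /dotp mulr_sumr; apply: eq_bigr => i _; rewrite mxE mulrA. Qed.

Lemma dotpNl u v : dotp (- u) v = - dotp u v.
Proof. by rewrite -scaleN1r dotpZl mulN1r. Qed.

Lemma dotpDr u v w : dotp u (v + w) = dotp u v + dotp u w.
Proof. by rewrite dotpC dotpDl !(dotpC u). Qed.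

Lemma dotpZr a u v : dotp u (a *: v) = a * dotp u v.
Proof. by rewrite dotpC dotpZl dotpC. Qed.

Lemma dotpNr u v : dotp u (- v) = - dotp u v.
Proof. by rewrite dotpC dotpNl dotpC. Qed.

Lemma dotp_ge0 u : 0 <= dotp u u.
Proof. by apply: sumr_ge0 => i _; rewrite -expr2 sqr_ge0. Qed.

Lemma enorm_ge0 u : 0 <= enorm u.
Proof. exact: sqrtr_ge0. Qed.

Lemma sqr_enorm u : enorm u ^+ 2 = dotp u u.
Proof. by rewrite sqr_sqrtr ?dotp_ge0. Qed.

(** This bridges the library max norm and the Euclidean one. Together with the continuity of
    [enorm], it transfers neighbourhoods, boundedness and limits between the two norms. *)
Lemma normr_le_enorm u : `|u| <= enorm u.
Proof.
rewrite [leLHS]/Num.norm /= mx_normrE; apply/bigmax_leP; split; first exact: enorm_ge0.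
move=> [i j] _ /=; rewrite ord1 -sqrtr_sqr ler_wsqrtr // expr2 /dotp (bigD1 j) //=.
by rewrite lerDl; apply: sumr_ge0 => k _; rewrite -expr2 sqr_ge0.
Qed.

Lemma enorm0 : enorm (0 : 'rV[R]_n) = 0.
Proof. by rewrite /enorm /dotp big1 ?sqrtr0 // => i _; rewrite mxE mul0r. Qed.

Lemma enorm_eq0 u : enorm u = 0 -> u = 0.
Proof.
by move=> u0; apply/eqP; rewrite -normr_le0 -u0 normr_le_enorm.
Qed.

Lemma enormZ a u : enorm (a *: u) = `|a| * enorm u.
Proof.
by rewrite /enorm dotpZl dotpZr mulrA -expr2 sqrtrM ?sqr_ge0 // sqrtr_sqr.
Qed.

Lemma enormN u : enorm (- u) = enorm u.
Proof. by rewrite -scaleN1r enormZ normrN1 mul1r. Qed.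

Lemma enormB u v : enorm (u - v) = enorm (v - u).
Proof. by rewrite -enormN opprB. Qed.

(** The square of [enorm v *: u - enorm u *: v] expands to 2|u||v|(|u||v| - <u,v>). Dividing by
    |u||v| requires both norms to be nonzero, hence the case splits. *)
Lemma cauchy_schwarz u v : dotp u v <= enorm u * enorm v.
Proof.
have [v0|v0] := eqVneq (enorm v) 0.
  rewrite v0 mulr0 (enorm_eq0 _ v0) /dotp big1 // => i _.
  by rewrite mxE mulr0.
have vgt0 : 0 < enorm v by rewrite lt_def v0 enorm_ge0.
have := dotp_ge0 (enorm v *: u - enorm u *: v).
rewrite !(dotpDl, dotpDr, dotpNl, dotpNr, dotpZl, dotpZr) -!sqr_enorm (dotpC v u).
move=> h; have [u0|u0] := eqVneq (enorm u) 0.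
  rewrite u0 mul0r (enorm_eq0 _ u0) /dotp big1 // => i _.
  by rewrite mxE mul0r.
have ugt0 : 0 < enorm u by rewrite lt_def u0 enorm_ge0.
have uv0 : 0 < enorm u * enorm v by exact: mulr_gt0.
rewrite -(ler_pM2l uv0); move: h.
set x := enorm u; set y := enorm v; set d := dotp _ _ => h.
have -> : x * y * (x * y) = x * y * d + (x * y * (x * y) - x * y * d) by ring.
rewrite lerDl; lra.
Qed.

Lemma ler_enormD u v : enorm (u + v) <= enorm u + enorm v.
Proof.
rewrite -ler_sqr ?nnegrE ?addr_ge0 ?enorm_ge0 //.
rewrite sqr_enorm dotpDl !dotpDr (dotpC v u) -!sqr_enorm.
by have := cauchy_schwarz u v; nra.
Qed.

Lemma enorm_split w u v : enorm (u - v) <= enorm (u - w) + enorm (w - v).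
Proof. by rewrite -{1}(subrK w u) -addrA ler_enormD. Qed.

Lemma dotp_continuous : continuous (fun u => dotp u u).
Proof.
move=> u; rewrite /dotp; apply: (@cvg_big _ _ +%R 0 predT _ _ (nbhs u)) => [|i _].
  exact: add_continuous.
by apply: cvgM; exact: coord_continuous.
Qed.

Lemma enorm_continuous : continuous (@enorm R n).
Proof.
move=> u; apply: (@continuous_comp _ _ _ (fun u => dotp u u) Num.sqrt).
  exact: dotp_continuous.
exact: sqrt_continuous.
Qed.

Lemma dist_continuous u : continuous (fun v => enorm (v - u)).
Proof.
move=> v; apply: (@continuous_comp _ _ _ (fun v => v - u) (@enorm R n)).
  by apply: (@continuousB _ _ _ id (cst u)); [by []|exact: cst_continuous].
exact: enorm_continuous.
Qed.

Lemma near_enorm u (e : R) : 0 < e -> \forall v \near u, enorm (v - u) < e.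
Proof.
move=> e0; have h : nbhs (enorm (u - u)) [set y | y < e].
  by apply: lt_nbhsl; rewrite subrr enorm0.
exact: (@dist_continuous u u _ h).
Qed.

Lemma nbhs_enorm u (P : set 'rV[R]_n) :
  nbhs u P -> exists2 d : R, 0 < d & forall v, enorm (v - u) < d -> P v.
Proof.
move=> /nbhs_ballP[d /= d0 dP]; exists d => // v vu; apply: dP.
rewrite -ball_normE /ball_ /= distrC.
exact: le_lt_trans (normr_le_enorm _) vu.
Qed.

Lemma closed_eball (c : 'rV[R]_n) (r : R) : closed [set x | enorm (x - c) <= r].
Proof.
have -> : [set x | enorm (x - c) <= r] =
    (fun x => enorm (x - c)) @^-1` [set y | y <= r] by [].
apply: closed_comp; last exact: closed_le.
by move=> x _; exact: dist_continuous.
Qed.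

Lemma closed_bounded_compact (A : set 'rV[R]_n) (c : 'rV[R]_n) (r : R) :
  closed A -> (forall x, A x -> enorm (x - c) <= r) -> compact A.
Proof.
move=> cA Ar; apply: bounded_closed_compact => //.
exists (`|c| + r); split; first exact: num_real.
move=> y ry x Ax; apply: le_trans (ltW ry).
rewrite -{1}(subrK c x) addrC; apply: le_trans (ler_normD _ _) _.
by rewrite lerD2l; apply: le_trans (normr_le_enorm _) (Ar _ Ax).
Qed.

End Euclidean.

(** * Lower semicontinuous functions and attainment of minima *)

Section LowerSemicontinuity.
Context {R : realType} {X : topologicalType}.
Local Open Scope ereal_scope.

(** Lower semicontinuity is stated for real thresholds. An infinite [t] can only be [-oo], and then
    any real below [g x] serves instead. *)
Lemma lsc_near (g : X -> \bar R) (x : X) (t : \bar R) :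
  lower_semicontinuous g -> t < g x -> \forall y \near x, t < g y.
Proof.
move=> lg; have : forall a, t <= a%:E -> a%:E < g x -> \forall y \near x, t < g y.
  move=> a ta /lg[V xV Va]; apply: filterS xV => y /Va; exact: le_lt_trans.
case: t => [a h /(h a)| |h]; [exact| by rewrite ltNge leey |].
case gx : (g x) => [b| |] // _.
  by apply: (h (b - 1)%R); rewrite ?leNye // gx lte_fin ltrBlDr ltrDl.
by apply: (h 0%R); rewrite ?leNye // gx ltry.
Qed.

Lemma lscD (g : X -> \bar R) (h : X -> R) :
  lower_semicontinuous g -> continuous h ->
  lower_semicontinuous (fun x => g x + (h x)%:E).
Proof.
move=> lg ch x a; rewrite -lteBlDr // -EFinB => agx.
have [b ab bg] : exists2 b : R, (a - h x < b)%R & b%:E < g x.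
  move: agx; case: (g x) => [r| |] //; rewrite ?lte_fin.
    by move=> ar; exists ((a - h x + r) / 2)%R; rewrite ?lte_fin; lra.
  by move=> _; exists (a - h x + 1)%R; rewrite ?ltry // ltrDl.
have hab : \forall y \near x, (a - b < h y)%R.
  have := ch x [set y | a - b < y]%R; apply; apply: lt_nbhsr; lra.
exists [set y | a%:E < g y + (h y)%:E] => //=.
have := lsc_near _ _ _ lg bg; apply: filterS2 hab => y hy gy /=.
rewrite -lteBlDr // -EFinB; apply: lt_trans gy; rewrite lte_fin; lra.
Qed.

(** Without a minimizer, each point of [C] has a neighbourhood on which [g] exceeds some value of
    [g] on [C], hence also all smaller values. Near-covering compactness along the filter [F] of
    decreasing values gives one value [t] of [g] lying strictly below [g] on all of [C], which fails
    at the point where [t] is taken. *)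
Lemma lsc_min (C : set X) (g : X -> \bar R) :
  compact C -> C !=set0 -> lower_semicontinuous g ->
  exists2 x, C x & forall y, C y -> g x <= g y.
Proof.
move=> /compact_near_coveringP cC [x0 Cx0] lg; apply: contrapT => nomin.
pose F := filter_from (g @` C) (fun t => [set s | s <= t /\ (g @` C) s]).
have FF : Filter F.
  apply: filter_from_filter; first by exists (g x0), x0.
  move=> s t gs gt; exists (Order.min s t); first by case: leP.
  by move=> r [+ gr]; rewrite le_min => /andP[].
have [|t [x Cx gxt] /(_ (g x))] := cC _ F (fun t y => t < g y) FF.
  move=> x Cx; have [y Cy yx] : exists2 y, C y & g y < g x.
    apply: contrapT => h; apply: nomin; exists x => // y Cy.
    by rewrite leNgt; apply/negP => yx; apply: h; exists y.
  exists ([set x' | g y < g x'], [set s | s <= g y /\ (g @` C) s]) => /=.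
    by split; [exact: lsc_near|exists (g y) => //; exists y].
  by move=> [x' s] /= [yx' [sy _]]; exact: le_lt_trans yx'.
rewrite -gxt => /(_ (conj (lexx _) (ex_intro2 _ _ x Cx erefl)) x Cx).
by rewrite ltxx.
Qed.

End LowerSemicontinuity.

(** * Regular normals from quadratic estimates *)

Section RegularNormals.
Context {R : realType} {N : nat}.
Implicit Types (C : set 'rV[R]_N) (z xi : 'rV[R]_N).

(** A quadratic error is o(|z' - z|): it is at most e|z' - z| as soon as |z' - z| < e / (|L| +
    1). *)
Lemma proximal_regular_normal C z xi (L d : R) :
  C z -> 0 < d ->
  (forall z', C z' -> enorm (z' - z) < d ->
    dotp xi (z' - z) <= L * enorm (z' - z) ^+ 2) ->
  regular_normal_cone C z xi.
Proof.
move=> Cz d0 H; split=> // e e0.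
have L0 : 0 < `|L| + 1 by rewrite ltr_wpDl.
have b0 : 0 < Num.min d (e / (`|L| + 1)) by rewrite lt_min d0 divr_gt0.
apply: filterS (near_enorm z _ b0) => z'; rewrite lt_min => /andP[zd ze] Cz'.
apply: le_trans (H _ Cz' zd) _.
rewrite expr2 mulrA ler_wpM2r ?enorm_ge0 //.
move: ze; rewrite ltr_pdivlMr // => /ltW; apply: le_trans.
rewrite mulrC ler_wpM2l ?enorm_ge0 //.
by rewrite (le_trans (ler_norm L)) // lerDl.
Qed.

Lemma regular_normal_coneZ C z xi (t : R) :
  0 <= t -> regular_normal_cone C z xi -> regular_normal_cone C z (t *: xi).
Proof.
rewrite le_eqVlt => /predU1P[<-|t0] [Cz H]; split=> // e e0.
  apply: (@filterE _ (nbhs z)) => z' _; rewrite dotpZl mul0r mulr_ge0 ?enorm_ge0 //; exact: ltW.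
have et0 : 0 < e / t by exact: divr_gt0.
apply: filterS (H _ et0) => z' h /h.
by rewrite dotpZl mulrAC ler_pdivlMr // mulrC.
Qed.

End RegularNormals.

(** * Coordinates and norms in the product space of the epigraph *)

Section Epigraph.
Context {R : realType} {n : nat}.
Implicit Types (x y : 'rV[R]_n) (r s : R).

Lemma dotp_pt x y r s : dotp (pt x r) (pt y s) = dotp x y + r * s.
Proof.
rewrite /dotp big_split_ord /= big_ord1; congr (_ + _).
  by apply: eq_bigr => i _; rewrite !row_mxEl.
by rewrite !row_mxEr !mxE.
Qed.

Lemma ptB x y r s : pt x r - pt y s = pt (x - y) (r - s).
Proof.
by rewrite /pt opp_row_mx add_row_mx; congr row_mx; apply/matrixP => i j; rewrite !mxE.
Qed.

Lemma ptZ (t : R) x r : t *: pt x r = pt (t *: x) (t * r).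
Proof.
by rewrite /pt scale_row_mx; congr row_mx; apply/matrixP => i j; rewrite !mxE.
Qed.

Lemma sqr_enorm_pt x r : enorm (pt x r) ^+ 2 = enorm x ^+ 2 + r ^+ 2.
Proof. by rewrite !sqr_enorm dotp_pt -expr2. Qed.

Lemma enorm_pt_ge x r : enorm x <= enorm (pt x r).
Proof.
by rewrite -ler_sqr ?nnegrE ?enorm_ge0 // sqr_enorm_pt lerDl sqr_ge0.
Qed.

Lemma enorm_pt_le x r : enorm (pt x r) <= enorm x + `|r|.
Proof.
rewrite -ler_sqr ?nnegrE ?addr_ge0 ?enorm_ge0 // sqr_enorm_pt sqrrD.
rewrite -(real_normK (num_real r)) lerD2r lerDl.
by rewrite mulrn_wge0 // mulr_ge0 // enorm_ge0.
Qed.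

Lemma epi_pt (f : 'rV[R]_n -> \bar R) x r : epi f (pt x r) <-> (f x <= r%:E)%E.
Proof.
split=> [[y [s [/eq_row_mx[-> rs] fys]]]|]; last by exists x, r.
by move/matrixP: rs => /(_ ord0 ord0); rewrite !mxE => ->.
Qed.

End Epigraph.

(** * Sequential limits and compactness in the Euclidean norm *)

Section Sequences.
Context {R : realType} {n : nat}.
Implicit Types (w : nat -> 'rV[R]_n) (p : 'rV[R]_n).

Lemma cvg_enormP w p :
  w j @[j --> \oo] --> p <-> enorm (w j - p) @[j --> \oo] --> (0 : R).
Proof.
split=> wp.
  have : enorm (w j - p) @[j --> \oo] --> enorm (p - p).
    exact: (cvg_comp _ (fun v => enorm (v - p)) wp (@dist_continuous _ _ p p)).
  by rewrite subrr enorm0.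
apply/cvgrPdist_lt => e e0; move/cvgrPdist_lt : wp => /(_ e e0).
apply: filterS => j; rewrite sub0r normrN ger0_norm ?enorm_ge0 //.
by move=> h; rewrite distrC; exact: le_lt_trans (normr_le_enorm _) h.
Qed.

(** The indices [i_] need not increase; [j <= i_ j] is enough to carry limits at infinity over to
    the extracted sequence. *)
Lemma compact_subsequence (A : set 'rV[R]_n) w :
  compact A -> (forall k, A (w k)) ->
  exists (p : 'rV[R]_n) (i_ : nat -> nat),
    [/\ A p, forall j, (j <= i_ j)%N & w (i_ j) @[j --> \oo] --> p].
Proof.
move=> cA Aw.
have [|p [Ap clp]] := cA (w @ \oo) _; first by exists 0%N => // k _; exact: Aw.
have /choice[i_ iP] : forall j : nat, exists i,
    (j <= i)%N /\ enorm (w i - p) < j.+1%:R^-1 :> R.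
  move=> j; have j0 : 0 < j.+1%:R^-1 :> R by rewrite invr_gt0.
  have [|_ [[i /= ji <-] h]] := clp (w @` [set i | (j <= i)%N]) _ _ (near_enorm p _ j0).
    by exists j => // i /= ji; exists i.
  by exists i.
exists p, i_; split=> // [j|]; first by have [] := iP j.
apply/cvg_enormP; apply: (@squeeze_cvgr _ _ _ _ (cst 0) (fun j => j.+1%:R^-1)).
- by apply: nearW => j; rewrite enorm_ge0 /=; apply: ltW; have [] := iP j.
- exact: cvg_cst.
- exact: cvg_harmonic.
Qed.

End Sequences.

(** * Normals at minimizers of the quadratically penalized problem *)

Section PenalizedMinimizers.
Context {R : realType} {n : nat}.
Variables (f : 'rV[R]_n -> \bar R) (Omega : set 'rV[R]_n).
Implicit Types (x y : 'rV[R]_n) (r : R).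

Lemma sqr_enormB x' x y :
  enorm (x' - y) ^+ 2 =
    enorm (x' - x) ^+ 2 + 2 * dotp (x - y) (x' - x) + enorm (x - y) ^+ 2.
Proof.
have -> : x' - y = (x' - x) + (x - y) by rewrite addrA subrK.
move: (x' - x) (x - y) => v w.
by rewrite !sqr_enorm dotpDl !dotpDr (dotpC w v); ring.
Qed.

(** First-order condition in [x]: the gradient of the penalty at [x] is 2k(x - y), so its opposite
    is a proximal subgradient of [f]. The remainder k|x' - x|^2 of the expansion is the quadratic
    error. *)
Lemma minimizer_epi_normal x y r (k d : R) :
  f x = r%:E -> 0 < d ->
  (forall x', enorm (x' - x) < d ->
    (f x + (k * enorm (x - y) ^+ 2)%:E <= f x' + (k * enorm (x' - y) ^+ 2)%:E)%E) ->
  regular_normal_cone (epi f) (pt x r) (pt ((2 * k) *: (y - x)) (-1)).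
Proof.
move=> fx d0 xmin; apply: (@proximal_regular_normal _ _ _ _ _ `|k| d) => //.
  by apply/epi_pt; rewrite fx.
move=> _ [x' [r' [-> fx']]]; rewrite ptB => xd.
have {}xd := le_lt_trans (enorm_pt_ge _ _) xd.
have : (f x + (k * enorm (x - y) ^+ 2)%:E <= r'%:E + (k * enorm (x' - y) ^+ 2)%:E)%E.
  by apply: le_trans (xmin _ xd) _; rewrite leeD2r.
rewrite fx -!EFinD lee_fin (sqr_enormB x' x y) dotp_pt dotpZl -(opprB x y) dotpNl.
have : k * enorm (x' - x) ^+ 2 <= `|k| * enorm (pt (x' - x) (r' - r)) ^+ 2.
  apply: (@le_trans _ _ (`|k| * enorm (x' - x) ^+ 2)).
    by rewrite ler_wpM2r ?sqr_ge0 ?ler_norm.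
  by rewrite ler_wpM2l // sqr_enorm_pt lerDl sqr_ge0.
lra.
Qed.

(** The normal is minus the gradient in [y] of the two penalties. The coupling term enters with the
    sign opposite to that in [minimizer_epi_normal], so the two normals cancel up to
    [(2 * a) *: (y - x0)]. *)
Lemma minimizer_set_normal x y x0 (a k d : R) :
  Omega y -> 0 < d ->
  (forall y', Omega y' -> enorm (y' - y) < d ->
    a * enorm (y - x0) ^+ 2 + k * enorm (x - y) ^+ 2 <=
    a * enorm (y' - x0) ^+ 2 + k * enorm (x - y') ^+ 2) ->
  regular_normal_cone Omega y
    (- ((2 * k) *: (y - x)) - (2 * a) *: (y - x0)).
Proof.
move=> Oy d0 ymin; apply: (@proximal_regular_normal _ _ _ _ _ (a + k) d) => //.
move=> y' Oy' yd; have := ymin _ Oy' yd.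
rewrite (enormB x y) (enormB x y') (sqr_enormB y' y x0) (sqr_enormB y' y x).
move: (y' - y) (y - x) (y - x0) => w v v0.
rewrite dotpDl !dotpNl !dotpZl; lra.
Qed.

Hypotheses (f_proper : forall x, f x <> -oo%E) (f_lsc : lower_semicontinuous f)
  (Omega_closed : closed Omega).

(** Each point of [K] has a ball where the bound persists; compactness makes the radius uniform, so
    the bound also reaches points off [K]. The cap [d <= 1] later keeps [x] inside the ball of
    radius [rho + 1]. *)
Lemma uniform_lower_bound (K : set 'rV[R]_n) (l : R) :
  compact K -> (forall y, K y -> (l%:E < f y)%E) ->
  exists2 d : R, 0 < d <= 1 &
    forall x y, K y -> enorm (x - y) < d -> (l%:E < f x)%E.
Proof.
move=> /compact_near_coveringP cK lK.
have H : \forall d \near (0 : R)^'+,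
    K `<=` (fun y => forall x, enorm (x - y) < d -> (l%:E < f x)%E).
  apply: cK => y Ky; have [d d0 dP] := nbhs_enorm _ _ (lsc_near _ _ _ f_lsc (lK _ Ky)).
  have d20 : 0 < d / 2 by exact: divr_gt0.
  exists ([set y' | enorm (y' - y) < d / 2], [set e | e < d / 2]) => /=.
    by split; [exact: near_enorm|exact: nbhs_right_lt].
  move=> [y' e] /= [y'd ed] x xy'; apply: dP.
  by apply: le_lt_trans (enorm_split y' _ _) _; lra.
have [d [dP [d0 d1]]] :=
  filter_ex (filterI H (filterI (nbhs_right_gt 0) (nbhs_right_le ltr01))).
by exists d; [exact/andP|move=> x y /dP; apply].
Qed.

(* [f] may be unbounded below near [x0] off [Omega], so a weight [k] large
   compared with the minimum of [f] on a ball keeps [x] close to [y]. *)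
Lemma penalized_normals x0 (m a rho : R) :
  Omega x0 -> (forall x, Omega x -> (m%:E <= f x)%E) -> 0 < a -> 0 < rho ->
  (f x0 < (m + a * rho ^+ 2)%:E)%E ->
  exists x r y u,
    [/\ enorm (x - x0) <= rho + 1 /\ enorm (y - x0) <= rho,
        regular_normal_cone (epi f) (pt x r) (pt u (-1)) &
        regular_normal_cone Omega y (- u - (2 * a) *: (y - x0))].
Proof.
move=> Ox0 mf a0 rho0.
case f0 : (f x0) (f_proper x0) => [r0| |] // _; rewrite lte_fin => r0m.
have mr0 : m <= r0 by have := mf _ Ox0; rewrite f0 lee_fin.
pose K := Omega `&` [set y | enorm (y - x0) <= rho].
pose B := [set x | enorm (x - x0) <= rho + 1].
have Kx0 : K x0 by split=> //=; rewrite subrr enorm0 ltW.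
have Bx0 : B x0 by rewrite /B /= subrr enorm0; lra.
have cK : compact K.
  apply: (@closed_bounded_compact _ _ _ x0 rho); last by move=> x [].
  by apply: closedI => //; exact: closed_eball.
have cB : compact B.
  by apply: (@closed_bounded_compact _ _ _ x0 (rho + 1)) => //; exact: closed_eball.
(* The threshold [r0 - a * rho ^+ 2] lies strictly below [m] by the assumption on [f x0], so it is a
   strict lower bound of [f] on [K]. *)
have [d /andP[d0 d1] dP] : exists2 d : R, 0 < d <= 1 &
    forall x y, K y -> enorm (x - y) < d -> ((r0 - a * rho ^+ 2)%:E < f x)%E.
  apply: uniform_lower_bound => // y [Oy _].
  by apply: lt_le_trans (mf _ Oy); rewrite lte_fin; lra.
have [b Bb bmin] := lsc_min _ _ cB (ex_intro _ _ Bx0) f_lsc.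
have [m' m'f] : exists m' : R, forall x, B x -> (m'%:E <= f x)%E.
  have := bmin _ Bx0; rewrite f0.
  case fb : (f b) (f_proper b) => [m'| |] // _ _.
  by exists m' => x /bmin; rewrite fb.
have m'r0 : m' <= r0 by have := m'f _ Bx0; rewrite f0 lee_fin.
(* On [B], [f] falls below [r0] by at most [r0 - m']. Such a [k] makes a separation of [d] or more
   too costly for a minimizer. *)
have [k k0 kd] : exists2 k : R, 0 < k & r0 - m' < k * d ^+ 2.
  exists ((r0 - m' + 1) / d ^+ 2); first by rewrite divr_gt0 ?exprn_gt0 //; lra.
  by rewrite divfK ?expf_eq0 ?gt_eqF //; lra.
pose h (p : 'rV[R]_n * 'rV[R]_n) : R :=
  a * enorm (p.2 - x0) ^+ 2 + k * enorm (p.1 - p.2) ^+ 2.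
have ch : continuous h.
  have c2 : continuous (fun p : 'rV[R]_n * 'rV[R]_n => enorm (p.2 - x0)).
    move=> p; apply: (@continuous_comp _ _ _ snd (fun y => enorm (y - x0))).
      exact: cvg_snd.
    exact: dist_continuous.
  have c1 : continuous (fun p : 'rV[R]_n * 'rV[R]_n => enorm (p.1 - p.2)).
    move=> p; apply: (@continuous_comp _ _ _
      (fun p : 'rV[R]_n * 'rV[R]_n => p.1 - p.2) (@enorm R n)).
      by apply: (@continuousB _ _ _ fst snd); [exact: cvg_fst|exact: cvg_snd].
    exact: enorm_continuous.
  by move=> p; exact: (cvgD (cvgM (cvg_cst a) (cvgM (c2 p) (c2 p)))
    (cvgM (cvg_cst k) (cvgM (c1 p) (c1 p)))).
have lf1 : lower_semicontinuous (fun p : 'rV[R]_n * 'rV[R]_n => f p.1).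
  move=> p l /f_lsc[V Vp Vl]; exists [set q | V q.1] => [|q]; last exact: Vl.
  exact: (cvg_fst Vp).
have [|[x y] [/= Bx Ky] xymin] := lsc_min _ _ (compact_setX cB cK) _ (lscD _ _ lf1 ch).
  by exists (x0, x0).
(* The competitor [(x0, x0)] pays no penalty, so the minimal value is at most [r0]. *)
have := xymin (x0, x0) (conj Bx0 Kx0); rewrite /h /= f0 !subrr enorm0.
rewrite expr0n /= !mulr0 addr0 adde0.
case fx : (f x) (f_proper x) => [r| |] // _; rewrite -EFinD lee_fin => rle.
have m'r : m' <= r by have := m'f _ Bx; rewrite fx lee_fin.
have ay0 : 0 <= a * enorm (y - x0) ^+ 2 by rewrite mulr_ge0 ?sqr_ge0 ?ltW.
have ky0 : 0 <= k * enorm (x - y) ^+ 2 by rewrite mulr_ge0 ?sqr_ge0 ?ltW.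
have xyd : enorm (x - y) < d.
  by rewrite -ltr_sqr ?nnegrE ?enorm_ge0 ?(ltW d0) // -(ltr_pM2l k0); lra.
have lr := dP _ _ Ky xyd; rewrite fx lte_fin in lr.
(* Since [f x] exceeds [r0 - a * rho ^+ 2], the penalty at [y] stays below [a * rho ^+ 2]. Thus the
   ball constraint on [y] is inactive, and then the one on [x] is too, as |x - y| < d <= 1. *)
have yrho : enorm (y - x0) < rho.
  by rewrite -ltr_sqr ?nnegrE ?enorm_ge0 ?(ltW rho0) // -(ltr_pM2l a0); lra.
have xrho : enorm (x - x0) < rho + 1.
  by apply: le_lt_trans (enorm_split y _ _) _; lra.
exists x, r, y, ((2 * k) *: (y - x)); split; first by split; exact: ltW.
  apply: (@minimizer_epi_normal _ _ _ _ (rho + 1 - enorm (x - x0))) => //; first lra.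
  move=> x' x'd; have Bx' : B x'.
    by apply: le_trans (enorm_split x _ _) _; lra.
  have := xymin (x', y) (conj Bx' Ky).
  by rewrite /h /= !EFinD !(addeC (a * _)%:E) !addeA leeD2rE.
apply: (@minimizer_set_normal _ _ _ _ _ (rho - enorm (y - x0))); first by case: Ky.
  lra.
move=> y' Oy' y'd; have Ky' : K y'.
  by split => //=; apply: le_trans (enorm_split y _ _) _; lra.
by have := xymin (x, y') (conj Bx Ky'); rewrite /h /= fx leeD2lE.
Qed.

End PenalizedMinimizers.

(** * Limits of normals at infinity and linear growth *)

Section NormalsAtInfinity.
Context {R : realType} {n : nat}.
Variables (f : 'rV[R]_n -> \bar R) (Omega : set 'rV[R]_n).

Lemma cvg_pt (u : nat -> 'rV[R]_n) (t : nat -> R) p q :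
  u j @[j --> \oo] --> p -> t j @[j --> \oo] --> q ->
  pt (u j) (t j) @[j --> \oo] --> pt p q.
Proof.
move=> /cvg_enormP up tq; apply/cvg_enormP.
apply: (@squeeze_cvgr _ _ _ _ (cst 0) (fun j => enorm (u j - p) + `|t j - q|)).
- by apply: nearW => j; rewrite enorm_ge0 ptB enorm_pt_le.
- exact: cvg_cst.
- have := cvgD up (cvg_norm (cvgB tq (cvg_cst q))).
  by rewrite subrr normr0 addr0; apply.
Qed.

(** Scaling both normals by the same [t j] keeps them opposite up to [t j *: e j], which vanishes
    because [t] converges. The limits are therefore exactly opposite, and the last coordinate -1
    becomes [- q]. *)
Lemma limit_normals (x y u e : nat -> 'rV[R]_n) (r t : nat -> R) p q :
  (forall j, regular_normal_cone (epi f) (pt (x j) (r j)) (pt (u j) (-1))) ->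
  (forall j, regular_normal_cone Omega (y j) (- u j - e j)) ->
  enorm (x j) @[j --> \oo] --> +oo -> enorm (y j) @[j --> \oo] --> +oo ->
  e j @[j --> \oo] --> (0 : 'rV[R]_n) ->
  (forall j, 0 <= t j) ->
  t j *: u j @[j --> \oo] --> p -> t j @[j --> \oo] --> q ->
  epi_normal_cone_infty f (pt p (- q)) /\ normal_cone_infty Omega (- p).
Proof.
move=> Nf NO xoo yoo e0 t0 tup tq; split.
  exists x, r, (fun j => t j *: pt (u j) (-1)); split => //.
  - by move=> j; have [] := Nf j.
  - by move=> j; exact: regular_normal_coneZ.
  - under eq_fun do rewrite ptZ mulrN1.
    by apply: cvg_pt => //; exact: cvgN.
exists y, (fun j => t j *: (- u j - e j)); split => //.
- by move=> j; have [] := NO j.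
- by move=> j; exact: regular_normal_coneZ.
- under eq_fun do rewrite scalerBr scalerN.
  rewrite -(subr0 (- p)) -(scaler0 _ q).
  by apply: cvgB; [exact: cvgN|exact: cvgZ].
Qed.

Hypotheses (f_proper : forall x, f x <> -oo%E) (f_lsc : lower_semicontinuous f)
  (Omega_closed : closed Omega)
  (qualification : singular_subdiff_infty f `&`
            [set - xi | xi in normal_cone_infty Omega] `<=` [set 0])
  (noncritical :
    ~ [set u + xi | u in subdiff_infty f & xi in normal_cone_infty Omega] 0).

(* After the scaling by [1 / (1 + |u j|)], a limit point is normal data at
   infinity of slope [1 - |w|]: it contradicts [noncritical] when this is
   positive, and [qualification] when [|w| = 1]. *)
Lemma no_vanishing_normals (x y u e : nat -> 'rV[R]_n) (r : nat -> R) :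
  (forall j, regular_normal_cone (epi f) (pt (x j) (r j)) (pt (u j) (-1))) ->
  (forall j, regular_normal_cone Omega (y j) (- u j - e j)) ->
  enorm (x j) @[j --> \oo] --> +oo -> enorm (y j) @[j --> \oo] --> +oo ->
  e j @[j --> \oo] --> (0 : 'rV[R]_n) -> False.
Proof.
move=> Nf NO xoo yoo e0.
pose s j : R := (1 + enorm (u j))^-1.
have s0 j : 0 < s j by rewrite invr_gt0 ltr_pwDl ?enorm_ge0.
have sE j : s j = 1 - enorm (s j *: u j).
  rewrite enormZ gtr0_norm //; apply/eqP; rewrite eq_sym subr_eq -{1}(mulr1 (s j)).
  by rewrite -mulrDr mulVf // gt_eqF // ltr_pwDl ?enorm_ge0.
have s1 j : enorm (s j *: u j - 0) <= 1.
  by rewrite subr0 -subr_ge0 -sE ltW.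
have cB := @closed_bounded_compact R n _ 0 1 (closed_eball 0 1) (fun _ h => h).
have [w [i_ [Bw ij iw]]] := compact_subsequence _ (fun j => s j *: u j) cB s1.
have ioo : i_ j @[j --> \oo] --> \oo.
  move=> A [N _ NA]; exists N => // j /= Nj; apply: NA => /=.
  exact: leq_trans Nj (ij j).
have si : s (i_ j) @[j --> \oo] --> 1 - enorm w.
  under eq_fun do rewrite sE.
  apply: cvgB; first exact: cvg_cst.
  exact: (cvg_comp _ (@enorm R n) iw (@enorm_continuous _ _ w)).
(* The factor [c] normalizes the last coordinate: [c = 1] serves when |w| = 1, and
   [c = (1 - enorm w)^-1] turns it into -1 otherwise. *)
have key c : 0 <= c -> epi_normal_cone_infty f (pt (c *: w) (- (c * (1 - enorm w)))) /\
    normal_cone_infty Omega (- (c *: w)).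
  move=> c0; apply: (@limit_normals (x \o i_) (y \o i_) (u \o i_) (e \o i_) (r \o i_)
      (fun j => c * s (i_ j))).
  - by move=> j; exact: Nf.
  - by move=> j; exact: NO.
  - exact: (cvg_comp _ _ ioo xoo).
  - exact: (cvg_comp _ _ ioo yoo).
  - exact: (cvg_comp _ _ ioo e0).
  - by move=> j; rewrite mulr_ge0 // ltW.
  - under eq_fun do rewrite -scalerA.
    by apply: cvgZ => //; exact: cvg_cst.
  - by apply: cvgM => //; exact: cvg_cst.
have w1 : 0 <= 1 - enorm w.
  by move: Bw; rewrite /= subr0 -subr_ge0.
move: w1; rewrite le_eqVlt => /predU1P[w1|w1].
  have [] := key 1 ler01; rewrite -w1 scale1r mulr0 oppr0 => Nw Ow.
  have w0 : w = 0.
    by apply: qualification; split => //; exists (- w) => //; rewrite opprK.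
  by move: w1; rewrite w0 enorm0; lra.
have [] := key (1 - enorm w)^-1 _; first by rewrite invr_ge0 ltW.
rewrite mulVf ?gt_eqF // => Nw Ow; apply: noncritical.
by exists ((1 - enorm w)^-1 *: w) => //; eexists; [exact: Ow|rewrite subrr].
Qed.

(** Growth is measured by |x| instead of the distance to [Sol], so it is available before [Sol] is
    known to be nonempty; all three conclusions of the theorem are drawn from it. *)
Lemma linear_growth (m : R) :
  (forall x, Omega x -> (m%:E <= f x)%E) ->
  exists2 c : R, 0 < c & exists M : R, forall x, Omega x -> M < enorm x ->
    ((m + c * enorm x)%:E <= f x)%E.
Proof.
move=> mf; apply: contrapT => nogrowth.
have step (k : nat) : exists d : ('rV[R]_n * R) * (('rV[R]_n * 'rV[R]_n) * 'rV[R]_n),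
    let: ((x, r), ((y, u), e)) := d in
    [/\ regular_normal_cone (epi f) (pt x r) (pt u (-1)),
        regular_normal_cone Omega y (- u - e) &
        [/\ k%:R / 2 - 1 <= enorm x, k%:R / 2 - 1 <= enorm y
          & enorm e <= 4 * k.+1%:R^-1]].
  have k0 : 0 < k.+1%:R :> R by [].
  have [x0 [Ox0 kx0 fx0]] : exists x0, [/\ Omega x0, k.+1%:R < enorm x0 &
      (f x0 < (m + k.+1%:R^-1 * enorm x0)%:E)%E].
    apply: contrapT => h; apply: nogrowth; exists k.+1%:R^-1; first by rewrite invr_gt0.
    exists k.+1%:R => x Ox kx; rewrite leNgt; apply/negP => fx.
    by apply: h; exists x.
  have x00 : 0 < enorm x0 by exact: lt_trans kx0.
  (* With [rho = enorm x0 / 2], this gives a rho^2 = |x0| / (k + 1), the gap bounding [f x0 - m],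
     and 2 a rho = 4 / (k + 1), the bound on the residual. *)
  pose a := 4 * k.+1%:R^-1 / enorm x0.
  have a0 : 0 < a by rewrite divr_gt0 // mulr_gt0 // invr_gt0.
  have [|||||x [r [y [u [[xx0 yx0] Nf NO]]]]] :=
    @penalized_normals _ _ f Omega f_proper f_lsc Omega_closed x0 m a (enorm x0 / 2) => //.
  - exact: divr_gt0.
  - suff <- : k.+1%:R^-1 * enorm x0 = a * (enorm x0 / 2) ^+ 2 by [].
    rewrite /a; move: k.+1%:R k0 => N N0.
    by field; rewrite !gt_eqF.
  exists ((x, r), ((y, u), (2 * a) *: (y - x0))); split => //.
  have kk : k.+1%:R = k%:R + 1 :> R by rewrite -natr1.
  have := enorm_split x x0 0; have := enorm_split y x0 0.
  rewrite !subr0 (enormB x0 y) (enormB x0 x) => hy hx.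
  split; [lra|lra|].
  rewrite enormZ (gtr0_norm (mulr_gt0 (ltr0n _ 2) a0)).
  apply: (@le_trans _ _ (2 * a * (enorm x0 / 2))).
    by rewrite ler_wpM2l // mulr_ge0 // ltW.
  rewrite /a; move: k.+1%:R k0 => N N0.
  by rewrite le_eqVlt; apply/orP; left; apply/eqP; field; rewrite !gt_eqF.
have [d dP] := choice step.
have big (v : nat -> 'rV[R]_n) : (forall k, k%:R / 2 - 1 <= enorm (v k)) ->
    enorm (v k) @[k --> \oo] --> +oo.
  move=> vk; apply/cvgryPge => A.
  have /cvgryPge/(_ (2 * (A + 1))) := @cvgr_idn R.
  by apply: filterS => k Ak; apply: le_trans (vk k); lra.
apply: (@no_vanishing_normals (fun k => (d k).1.1) (fun k => (d k).2.1.1)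
  (fun k => (d k).2.1.2) (fun k => (d k).2.2) (fun k => (d k).1.2)).
- by move=> k; have := dP k; case: (d k) => [[? ?] [[? ?] ?]] [].
- by move=> k; have := dP k; case: (d k) => [[? ?] [[? ?] ?]] [].
- by apply: big => k; have := dP k; case: (d k) => [[? ?] [[? ?] ?]] [_ _ []].
- by apply: big => k; have := dP k; case: (d k) => [[? ?] [[? ?] ?]] [_ _ []].
- apply/cvg_enormP; apply: (@squeeze_cvgr _ _ _ _ (cst 0) (fun k => 4 * k.+1%:R^-1)).
  + apply: nearW => k; rewrite enorm_ge0 subr0 /=.
    by have := dP k; case: (d k) => [[? ?] [[? ?] ?]] [_ _ []].
  + exact: cvg_cst.
  + rewrite -[X in _ --> X](mulr0 (4 : R)).
    by apply: cvgM; [exact: cvg_cst|exact: cvg_harmonic].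
Qed.

End NormalsAtInfinity.

(** * Solution set, error bound and coercivity from linear growth *)

Theorem theorem6p4 (R : realType) (n : nat) (f : 'rV[R]_n -> \bar R)
    (Omega : set 'rV[R]_n)
    (f_proper : forall x, f x <> -oo%E)
    (f_lsc : lower_semicontinuous f)
    (Omega_closed : closed Omega)
    (A1 : unbounded (edom f `&` Omega))
    (A2 : singular_subdiff_infty f `&`
            [set - xi | xi in normal_cone_infty Omega] = [set 0])
    (A3 : fstar f Omega \is a fin_num)
    (H0 : ~ [set u + xi | u in subdiff_infty f & xi in normal_cone_infty Omega] 0) :
  [/\ Sol f Omega !=set0 /\ compact (Sol f Omega),
      exists c r : R, [/\ 0 < c, 0 < r &
        forall x, Omega x -> r < enorm x ->
          (c%:E * edistance x (Sol f Omega) <= f x - fstar f Omega)%E]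
    & coercive_on f Omega].
Proof.
have mf x : Omega x -> ((fine (fstar f Omega))%:E <= f x)%E.
  by move=> Ox; rewrite fineK //; apply: ereal_inf_lbound; exists x.
have A2' : singular_subdiff_infty f `&`
    [set - xi | xi in normal_cone_infty Omega] `<=` [set 0] by rewrite A2.
have [c c0 [M growth]] := @linear_growth _ _ f Omega f_proper f_lsc Omega_closed A2' H0 _ mf.
set m := fine _ in mf growth.
have mE : fstar f Omega = m%:E by rewrite /m fineK.
have coercive : coercive_on f Omega.
  move=> L; exists (Num.max M ((L - m) / c)) => x Ox; rewrite gt_max => /andP[Mx Lx].
  apply: lt_le_trans (growth _ Ox Mx); rewrite lte_fin.
  by move: Lx; rewrite ltr_pdivrMr // mulrC; lra.
have [s Ss] : Sol f Omega !=set0.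
  have [_ [x1 Ox1 <-] fx1] : exists2 y, (f @` Omega) y & (y < (m + 1)%:E)%E.
    by apply: ereal_inf_lt; rewrite -/(fstar f Omega) mE lte_fin ltrDl.
  have [r rP] := coercive (m + 1).
  (* The ball contains [x1], where [f] is below [m + 1], while [f] exceeds [m + 1] outside it. A
     minimizer on the ball is thus a global one on [Omega]. *)
  pose rho := Num.max r (enorm x1).
  pose K := Omega `&` [set x | enorm (x - 0) <= rho].
  have Kx1 : K x1 by split => //=; rewrite subr0 le_max lexx orbT.
  have cK : compact K.
    apply: (@closed_bounded_compact _ _ _ 0 rho) => [|x []//].
    by apply: closedI => //; exact: closed_eball.
  have [z [Oz _] zmin] := lsc_min _ _ cK (ex_intro _ _ Kx1) f_lsc.
  exists z; split => //; apply/eqP; rewrite eq_le; apply/andP; split; last first.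
    by apply: ereal_inf_lbound; exists z.
  apply/ereal_infP => _ [x Ox <-].
  have [xrho|rhox] := leP (enorm x) rho.
    by apply: zmin; split => //=; rewrite subr0.
  apply: le_trans (zmin _ Kx1) (ltW (lt_trans fx1 (rP _ Ox _))).
  by apply: le_lt_trans rhox; rewrite le_max lexx.
split=> //.
  split; first by exists s.
  have [r rP] := coercive m.
  (* [Sol] is the sublevel set at the minimal value: closed by lower semicontinuity, bounded by
     coercivity. *)
  have SE : Sol f Omega = Omega `&` ~` [set x | (m%:E < f x)%E].
    apply/seteqP; split => x [Ox fx]; split => //=; first by rewrite fx mE ltxx.
    apply/eqP; rewrite mE eq_le mf // andbT leNgt; exact/negP.
  apply: (@closed_bounded_compact _ _ _ 0 r).
    rewrite SE; apply: closedI => //; apply: open_closedC.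
    by move/lower_semicontinuousP : f_lsc; apply.
  move=> x [Ox fx]; rewrite subr0 leNgt; apply/negP => /(rP _ Ox).
  by rewrite fx mE ltxx.
(* The distance to [Sol] is at most |x - s|, which is at most 2|x| once |x| > |s|; this halves the
   growth constant. The term [enorm s + 1] also makes the radius positive. *)
exists (c / 2), (Num.max M (enorm s + 1)); split; first exact: divr_gt0.
  by rewrite lt_max; apply/orP; right; rewrite ltr_wpDl ?enorm_ge0.
move=> x Ox; rewrite gt_max => /andP[Mx sx].
apply: (@le_trans _ _ ((c / 2)%:E * (enorm (x - s))%:E)%E).
  apply: lee_wpmul2l; first by rewrite lee_fin divr_ge0 ?ltW.
  by apply: ereal_inf_lbound; exists s.
rewrite mE leeBrDr // -EFinM -EFinD.
apply: le_trans (growth _ Ox Mx); rewrite lee_fin addrC lerD2l.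
have : enorm (x - s) <= 2 * enorm x.
  by apply: le_trans (ler_enormD _ _) _; rewrite enormN; lra.
by move=> h; rewrite -mulrA ler_pM2l //; lra.
Qed.
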